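(* The functional $\Omega_b$ is not computable in $\boldsymbol{\lambda}_C$ and $\exists^2$.
   Context: Computability is Kleene's higher-order computability (S1–S9), extended to partial functionals. $\exists^2:\mathbb{N}^{\mathbb{N}}\to\{0,1\}$ satisfies $\exists^2(g)=0\leftrightarrow(\exists n)(g(n)=0)$. Subsets of $2^{\mathbb{N}}$ are given by characteristic functions. $\Omega_b$ is defined exactly on $X\subseteq2^{\mathbb{N}}$ with at most one element, with value $0$ if $X=\emptyset$ and $1$ otherwise. $\boldsymbol{\lambda}_C$ is the partial functional that maps each closed $C\subseteq2^{\mathbb{N}}$ to its measure under the product (coin-tossing) measure on $2^{\mathbb{N}}$ (given as a fast-converging sequence of rationals); modulo $\exists^2$ this is equivalent to the Lebesgue measure restricted to closed subsets of $[0,1]$. *)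

(* Defs.v *)
From HB Require Import structures.
From mathcomp Require Import ring lra.
From mathcomp Require Import all_boot all_order all_algebra.
From mathcomp Require Import all_classical all_reals all_analysis.
Set Implicit Arguments.
Unset Strict Implicit.
Unset Printing Implicit Defensive.
Import Order.TTheory GRing.Theory Num.Theory.
Import numFieldNormedType.Exports.
Local Open Scope classical_set_scope.
Local Open Scope ring_scope.

Definition fun1 := nat -> nat.
Definition fun2 := fun1 -> nat.
(* Partial functionals with total arguments of type 2 and values in N^N;
   [None] means undefined. *)
Definition pfun3 := fun2 -> option fun1.

Inductive arg : Type :=
| A0 of nat
| A1 of fun1
| A2 of fun2
| A3 of pfun3.

Definition idx (s : seq nat) : nat := CodeSeq.code s.

(* [kleene e args y] is {e}(args) = y, by Kleene's schemes S1-S9 with numerical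
   indices.  In S8 the functional argument must be total on N^N (for all numbers
   at type 2, for all functions at type 3), and, at type 3, the oracle must be
   defined at it.  The value of a type-3 oracle is an element of N^N, which is
   evaluated at the next argument. *)
Inductive kleene : nat -> seq arg -> nat -> Prop :=
| S1 x args :
    kleene (idx [:: 1%N]) (A0 x :: args) x.+1
| S2 q args :
    kleene (idx [:: 2%N; q]) args q
| S3 x args :
    kleene (idx [:: 3%N]) (A0 x :: args) x
| S4 d1 d2 args x y :
    kleene d2 args x ->
    kleene d1 (A0 x :: args) y ->
    kleene (idx [:: 4%N; d1; d2]) args y
| S5_0 d1 d2 args y :
    kleene d1 args y ->
    kleene (idx [:: 5%N; d1; d2]) (A0 0%N :: args) y
| S5_S d1 d2 args x z y :
    kleene (idx [:: 5%N; d1; d2]) (A0 x :: args) z ->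
    kleene d2 [:: A0 x, A0 z & args] y ->
    kleene (idx [:: 5%N; d1; d2]) (A0 x.+1 :: args) y
| S6 d (s : seq nat) args y :
    perm_eq s (iota 0 (size args)) ->
    kleene d [seq nth (A0 0%N) args i | i <- s] y ->
    kleene (idx [:: 6%N, d & s]) args y
| S7 f x args :
    kleene (idx [:: 7%N]) [:: A1 f, A0 x & args] (f x)
| S8_2 d (F : fun2) args (f : fun1) :
    (forall n, kleene d [:: A0 n, A2 F & args] (f n)) ->
    kleene (idx [:: 8%N; 2%N; d]) (A2 F :: args) (F f)
| S8_3 d (Phi : pfun3) x args (G : fun2) (h : fun1) :
    (forall f, kleene d [:: A1 f, A3 Phi, A0 x & args] (G f)) ->
    Phi G = Some h ->
    kleene (idx [:: 8%N; 3%N; d]) [:: A3 Phi, A0 x & args] (h x)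
| S9 m x args y :
    (m <= size args)%N ->
    kleene x (take m args) y ->
    kleene (idx [:: 9%N; m]) (A0 x :: args) y.

(* A partial functional is computable in [oracles] when one index gives the
   right value at every point of its domain. *)
Definition computable_in (Psi : fun2 -> option nat) (oracles : seq arg) : Prop :=
  exists e : nat, forall (F : fun2) (y : nat),
    Psi F = Some y -> kleene e (A2 F :: oracles) y.

Definition E2 : fun2 :=
  fun g => if `[< exists n, g n = 0%N >] then 0%N else 1%N.

(* A type-2 functional is read as a characteristic function of a subset of 2^N
   through its restriction to the 0-1 valued functions. *)
Definition seq01 (x : cantor_space) : fun1 := fun n => nat_of_bool (x n).
Definition is_charfun (F : fun2) : Prop := forall x, (F (seq01 x) <= 1)%N.
Definition set_of (F : fun2) : set cantor_space :=
  [set x | F (seq01 x) = 1%N].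

Definition Omega_b : fun2 -> option nat := fun F =>
  if `[< is_charfun F /\ is_subset1 (set_of F) >]
  then Some (if `[< set_of F = set0 >] then 0%N else 1%N)
  else None.

Definition cylinder (n : nat) (s : cantor_space) : set cantor_space :=
  [set x | forall i, (i < n)%N -> x i = s i].
Definition cylinders : set (set cantor_space) :=
  [set A | exists n s, A = cylinder n s].
Definition cantor_borel := g_sigma_algebraType cylinders.

Definition coin_tossing (R : realType) (mu : probability cantor_borel R) : Prop :=
  forall n s, mu (cylinder n s) = (2 ^- n)%:E.

(* The real [mu C] is given by the rationals floor(2^n mu(C)) / 2^n, at distance
   less than 2^-n from it; each is coded by numerator and denominator.  The
   sequence thus depends on the real [mu C] only. *)
Definition lambda_C (R : realType) (mu : probability cantor_borel R) : pfun3 :=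
  fun F =>
  if `[< is_charfun F /\ closed (set_of F) >]
  then Some (fun n =>
    CodeSeq.code
      [:: Num.truncn (2 ^+ n * fine (mu (set_of F)) : R); (2 ^ n)%N])
  else None.
(* Existence of the coin-tossing measure: it is the image of Lebesgue measure on
   [0, 1[ under binary expansion. *)
Definition kn (R : realType) (n : nat) (x : R) : nat := Num.truncn (2 ^+ n * x).
Definition bits (R : realType) (x : measurableTypeR R) : cantor_borel :=
  fun n => odd (kn n.+1 x).

Lemma kn_half (R : realType) n (x : R) : 0 <= x -> (kn n.+1 x)./2 = kn n x.
Proof.
move=> x0; apply/esym/truncn_def.
have h : 0 <= 2 ^+ n.+1 * x by rewrite mulr_ge0 ?exprn_ge0.
have := truncn_itv h; rewrite -/(kn n.+1 x) exprS -mulrA.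
set y := 2 ^+ n * x; set k := kn _ _ => /andP[h1 h2].
have e : k%:R = (odd k)%:R + 2 * (k./2)%:R :> R.
  by rewrite -{1}(odd_double_half k) natrD -mul2n natrM.
have o1 : ((odd k)%:R : R) <= 1 by case: (odd k).
have o0 : 0 <= ((odd k)%:R : R) by case: (odd k).
move: h1 h2; rewrite -!natr1 e => h1 h2.
by apply/andP; split; lra.
Qed.

Fixpoint kval (s : nat -> bool) n : nat :=
  if n is m.+1 then (s m + (kval s m).*2)%N else 0%N.

Lemma kval_lt s n : (kval s n < 2 ^ n)%N.
Proof.
elim: n => //= n IH; rewrite expnS mul2n.
by case: (s n); rewrite ?add0n ?add1n ?ltn_Sdouble ?ltn_double.
Qed.

Lemma bits_cyl (R : realType) n s (x : R) : 0 <= x -> x < 1 ->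
  (cylinder n s (bits x) <-> kn n x = kval s n).
Proof.
move=> x0 x1; elim: n => [|n IH].
  split => // _; apply: truncn_def; rewrite expr0 mul1r.
  by apply/andP.
have -> : cylinder n.+1 s (bits x) <-> cylinder n s (bits x) /\ bits x n = s n.
  split=> [h|[h1 h2] i].
    by split=> [i /ltnW hi|]; apply: h.
  by rewrite ltnS leq_eqVlt => /predU1P[->//|/h1].
rewrite IH /bits -(kn_half n x0) /=; split=> [[<- <-]|->].
  by rewrite odd_double_half.
rewrite halfD oddD odd_double addbF half_double oddb; split=> //.
by rewrite andbF; case: (s n).
Qed.

Lemma bits_preim (R : realType) n s :
  (@bits R) @^-1` cylinder n s `&` `[0, 1[ =
  [set` `[(kval s n)%:R / 2 ^+ n, (kval s n).+1%:R / 2 ^+ n[%R ] :> set R.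
Proof.
have p : 0 < 2 ^+ n :> R by rewrite exprn_gt0.
apply/seteqP; split=> x /=; rewrite !in_itv /=.
  move=> [h /andP[x0 x1]]; move/(bits_cyl n s x0 x1): h => <-.
  rewrite ler_pdivrMr // ltr_pdivlMr // mulrC; apply: truncn_itv.
  by rewrite mulr_ge0 // ltW.
move=> /andP[h1 h2].
have x0 : 0 <= x by rewrite (le_trans _ h1) // divr_ge0 // ltW.
have x1 : x < 1.
  rewrite (lt_le_trans h2) // ler_pdivrMr // mul1r -natrX ler_nat.
  exact: kval_lt.
split; last by apply/andP.
apply/(bits_cyl n s x0 x1)/truncn_def.
by move: h1 h2; rewrite ler_pdivrMr // ltr_pdivlMr // mulrC => -> ->.
Qed.

Lemma measurable_kn (R : realType) n k : measurable [set x : R | kn n x = k].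
Proof.
have p : 0 < 2 ^+ n :> R by rewrite exprn_gt0.
have H j : measurable [set x : R | (kn n x <= j)%N].
  rewrite (_ : [set _ | _] = [set` `]-oo, (j.+1%:R / 2 ^+ n)[%R]) //.
  apply/seteqP; split => x /=; rewrite in_itv /= /kn truncn_le_nat;
    by rewrite ltr_pdivlMr // mulrC.
case: k => [|k].
  rewrite (_ : [set _ | _] = [set x : R | (kn n x <= 0)%N]) //.
  by apply/seteqP; split => x /=; rewrite leqn0 => /eqP.
rewrite (_ : [set _ | _] = [set x : R | (kn n x <= k.+1)%N] `\`
   [set x : R | (kn n x <= k)%N]); first exact: measurableD.
apply/seteqP; split => x /=; first by move=> ->; split=> //; rewrite ltnn.
by move=> [h1 /negP h2]; apply/eqP; rewrite eqn_leq h1 ltnNge.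
Qed.

Lemma measurable_bits (R : realType) : measurable_fun setT (@bits R).
Proof.
apply: (@measurability _ _ (measurableTypeR R) cantor_borel setT (@bits R) cylinders) => //.
move=> _ [_ [n [s ->]] <-]; rewrite setTI.
have -> : @bits R @^-1` cylinder n s =
    \bigcap_(i in [set i | (i < n)%N]) \bigcup_(k in [set k | odd k = s i])
       [set x : R | kn i.+1 x = k].
  apply/seteqP; split => x /= h i hi.
    by exists (kn i.+1 x) => //=; exact: h.
  by have [k /= <- <-] := h i hi.
apply: bigcap_measurableType => // i _; apply: bigcup_measurable => k _.
exact: measurable_kn.
Qed.

Lemma coin_tossing_exists (R : realType) :
  exists mu : probability cantor_borel R, coin_tossing mu.
Proof.
have mD : measurable (`[0, 1[ : set (measurableTypeR R)) by exact: measurable_itv.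
pose c : set cantor_borel -> \bar R :=
  pushforward (mrestr (@lebesgue_measure R) mD) (@bits R).
have cC n s : c (cylinder n s) = (2 ^- n)%:E.
  rewrite /c /pushforward /mrestr bits_preim lebesgue_measure_itv /= lte_fin.
  rewrite ltr_pM2r ?invr_gt0 ?exprn_gt0 // ltr_nat ltnSn -EFinB; congr _%:E.
  by rewrite -mulrBl -natr1 addrAC subrr add0r mul1r.
have c1 : c setT = 1%E.
  have := cC 0%N (fun=> false); rewrite expr0 invr1 => <-.
  by congr c; apply/seteqP; split.
have c0 : c set0 = 0%E by rewrite /c /pushforward preimage_set0 measure0.
have cp A : (0 <= c A)%E by rewrite /c /pushforward; exact: (measure_ge0 (mrestr (@lebesgue_measure R) mD)).
have cs : semi_sigma_additive c.
  move=> F mF tF mUF; rewrite /c /pushforward preimage_bigcup.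
  apply: measure_semi_sigma_additive.
  - by move=> n; rewrite -[X in measurable X]setTI; exact: measurable_bits.
  - apply/trivIsetP => /= i j _ _ ij; rewrite -preimage_setI.
    by move/trivIsetP : tF => /(_ _ _ _ _ ij) ->//; rewrite preimage_set0.
  - rewrite -preimage_bigcup -[X in measurable X]setTI.
    exact: measurable_bits.
pose m := HB.pack_for (Measure.type cantor_borel R) c
  (isMeasure.Build _ _ _ c c0 cp cs).
pose P := HB.pack_for (probability cantor_borel R) c (Measure.on m)
  (Measure_isProbability.Build _ _ _ m c1).
by exists P.
Qed.

(* Main.v *)
From HB Require Import structures.
Require Import Defs.
From mathcomp Require Import all_boot all_order all_algebra.
From mathcomp Require Import all_classical all_reals all_analysis.
From mathcomp Require Import measurable_realfun.
Set Implicit Arguments.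
Unset Strict Implicit.
Unset Printing Implicit Defensive.
Import Order.TTheory GRing.Theory Num.Theory.
Import numFieldNormedType.Exports.
Local Open Scope classical_set_scope.
Local Open Scope ring_scope.

(* The computations on the empty set and on {x} are compared for random x.  The
   points w of 2^N are split into independent columns: column 0 is x, the other
   ones are the functions over which the arguments of [lambda_C] quantify, one
   fresh column for each nested application.  The states of a computation then
   become countably many symbolic states, and a "system" assigns to each of them
   a partial function of w.  One step of a computation on the empty set acts on
   systems once "for all f" in S8 for [lambda_C] is weakened to "for almost all
   f", which is harmless since [lambda_C] only sees the measure of a set.  All
   domains now are measurable, so that a maximal system reachable from the empty
   one exists and is closed under steps up to a null set: no transfinite
   iteration is needed, nor the measurability of actual domains of computation.
   By Fubini there is a null set outside of which the actual computations, on the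
   empty set as well as on {column 0 of w}, have the value given by the system:
   the functions to which {x} is applied do not depend on column 0, hence differ
   from x almost surely. *)

(** * The coin-tossing measure on Cantor space *)

(** Cylinders are indexed by finite bit strings, so [U] is the countable union of those that it
    contains. *)
Lemma measurable_cylinder_union (U : set cantor_borel) :
  (forall x, U x -> exists n, cylinder n x `<=` U) -> measurable U.
Proof.
move=> hU; pose C (l : seq bool) : set cantor_borel := cylinder (size l) (nth false l).
have -> : U = \bigcup_(l : seq bool) (if `[< C l `<=` U >] then C l else set0).
  apply/seteqP; split=> [x Ux|x [l _]]; last by case: asboolP => // CU /CU.
  have [n nU] := hU x Ux.
  have e i : (i < n)%N -> nth false (mkseq x n) i = x i by exact: nth_mkseq.
  exists (mkseq x n) => //; case: asboolP => [_|[]]; rewrite /C size_mkseq.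
    by move=> i /e ->.
  by move=> y hy; apply: nU => i ni; rewrite hy ?e.
apply: countable_bigcupT_measurable => [|l]; first exact: countableP.
case: asboolP => // _; apply: sub_sigma_algebra.
by exists (size l), (nth false l).
Qed.

Lemma measurable_closed_cantor (C : set cantor_borel) :
  closed (C : set cantor_space) -> measurable C.
Proof.
move=> cC; rewrite -[C]setCK; apply: measurableC.
apply: measurable_cylinder_union => x nCx.
have oC : nbhs (x : cantor_space) (~` C) by apply: open_nbhs_nbhs; split=> //; exact: closed_openC.
(* The cylinders around [x] generate a filter converging to [x] in each coordinate, hence in the
   product topology, so one of them lies in the open complement. *)
pose F : set_system cantor_space := filter_from setT (fun n => cylinder n x).
have FF : Filter F.
  apply: filter_from_filter; first by exists 0%N.
  move=> i j _ _; exists (maxn i j) => // y hy.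
  by split=> k hk; apply: hy; rewrite leq_max hk ?orbT.
have : {ptws, F --> (x : nat -> bool)}.
  apply/pointwise_cvgP => t A /nbhs_singleton At.
  by exists t.+1 => // y /= ->.
by move=> /(_ _ oC) [n _ nC]; exists n.
Qed.

Lemma measurable_bit i b : measurable [set x : cantor_borel | x i = b].
Proof.
by apply: measurable_cylinder_union => x /= <-; exists i.+1 => y /= ->.
Qed.

Lemma measurable_fun_cantor d (T : measurableType d) (f : T -> cantor_borel) :
  (forall i b, measurable [set t | f t i = b]) -> measurable_fun setT f.
Proof.
move=> mf.
apply: (@measurability _ _ _ cantor_borel setT f cylinders) => //.
move=> _ [_ [n [s ->]] <-]; rewrite setTI.
rewrite (_ : _ @^-1` _ = \bigcap_(i in [set i | (i < n)%N]) [set t | f t i = s i]) //.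
exact: bigcap_measurableType.
Qed.

Lemma measurable_constraints (l : seq nat) (s : nat -> bool) :
  measurable [set x : cantor_borel | {in l, forall i, x i = s i}].
Proof.
rewrite (_ : [set _ | _] = \bigcap_(i in [set i | i \in l]) [set x | x i = s i]) //.
by apply: bigcap_measurableType => i _; exact: measurable_bit.
Qed.

(** The constrained positions need not form an initial segment. Missing positions are added one at a
    time, splitting the set into two halves, until a cylinder is reached. *)
Lemma coin_tossing_seq (R : realType) (mu : probability cantor_borel R) :
  coin_tossing mu -> forall l s, uniq l ->
  mu [set x : cantor_borel | {in l, forall i, x i = s i}] = (2 ^- size l)%:E.
Proof.
move=> hmu l s ul; pose A (l : seq nat) (s : nat -> bool) := [set x : cantor_borel | {in l, forall i, x i = s i}].
have mA l' s' : measurable (A l' s') by exact: measurable_constraints.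
have [n ln] : exists n, {in l, forall i, (i < n)%N}.
  by exists (\max_(i <- l) i).+1 => i il; rewrite ltnS leq_bigmax_seq.
(* [k] bounds the number of positions below [n] that are not yet constrained. *)
have [k hn] : exists k, (n <= size l + k)%N by exists n; rewrite leq_addl.
elim: k l s ul ln hn => [|k IH] l s ul ln hn.
  have sl : {subset l <= iota 0 n} by move=> j /ln; rewrite mem_iota.
  have [|szl pl] := uniq_min_size ul sl; first by rewrite size_iota -(addn0 (size l)).
  rewrite -/(A l s) (_ : A l s = cylinder n s) ?hmu ?szl ?size_iota //.
  by apply/seteqP; split=> x h i hi; apply: h; rewrite ?pl mem_iota // in hi *.
case: (pselect (exists2 i, (i < n)%N & i \notin l)) => [[i hi il]|all]; last first.
  apply: IH => //; apply: leq_trans (leq_addr _ _).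
  suff : {subset iota 0 n <= l} by move/(uniq_leq_size (iota_uniq 0 n)); rewrite size_iota.
  move=> i; rewrite mem_iota => hi; apply/negPn/negP => il.
  by apply: all; exists i.
pose t b := fun j => if j == i then b else s j.
have hA b : mu (A (i :: l) (t b)) = (2 ^- (size l).+1)%:E.
  apply: IH => /=; first by rewrite il.
    by move=> j; rewrite inE => /predU1P[->//|/ln].
  by rewrite addSnnS.
have -> : [set x : cantor_borel | {in l, forall i, x i = s i}] =
    A (i :: l) (t true) `|` A (i :: l) (t false).
  apply/seteqP; split=> x /=.
    move=> h; case xi : (x i); [left|right] => j; rewrite inE /t;
    by case: (eqVneq j i) => [-> //|_ /= /h].
  have ne j : j \in l -> (j == i) = false by move=> jl; apply: contraNF il => /eqP <-.
  by case=> h j jl; have := h j; rewrite inE jl orbT /t ne // => ->.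
rewrite measureU //; last first.
  apply/seteqP; split=> // x [h1 h2]; have := h1 i; have := h2 i.
  by rewrite !inE eqxx /t eqxx /= => -> // /(_ isT).
transitivity ((2 ^- (size l).+1)%:E + (2 ^- (size l).+1)%:E : \bar R)%E.
  by congr (_ + _)%E; exact: hA.
rewrite -EFinD; congr _%:E; rewrite exprS invfM -mulrDl -mulr2n -(mulr_natl 2^-1) divff ?mul1r //.
Qed.

(** Two cylinders are nested or disjoint, so together with the empty set they form a generating
    family closed under intersection. *)
Lemma coin_tossing_unique (R : realType) (mu nu : probability cantor_borel R) :
  coin_tossing mu -> coin_tossing nu ->
  forall A, measurable A -> mu A = nu A.
Proof.
move=> hmu hnu; pose G : set (set cantor_borel) := cylinders `|` [set set0].
apply: (@measure_unique _ R cantor_borel G (fun=> setT)).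
- apply/seteqP; split.
    apply: smallest_sub => [|A cA]; first exact: smallest_sigma_algebra.
    by apply: sub_sigma_algebra; left.
  apply: smallest_sub => [|A [|->//]]; first exact: sigma_algebra_measurable.
  exact: sub_sigma_algebra.
- move=> A B [[n [s ->]]|->]; last by rewrite set0I; right.
  case=> [[m [t ->]]|->]; last by rewrite setI0; right.
  wlog nm : n m s t / (n <= m)%N.
    move=> H; case: (leqP n m) => [/H//|/ltnW/H h]; rewrite setIC; exact: h.
  case: (pselect (cylinder n s t)) => [st|nst]; [left|right].
    exists m, t; apply/seteqP; split=> [x []//|x h]; split=> // i hi.
    by rewrite h ?st // (leq_trans hi).
  apply/seteqP; split=> // x [h1 h2]; apply: nst => i hi.
  by rewrite -h1 // h2 // (leq_trans hi).
- by left; exists 0%N, (fun=> false); apply/seteqP; split.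
- exact: bigcup_const.
- move=> A [[n [s ->]]|->]; last by rewrite !measure0.
  exact: etrans (hmu n s) (esym (hnu n s)).
- by move=> _; apply: le_lt_trans (probability_le1 mu measurableT) (ltry _).
Qed.

(** For each [n], such a set lies in a cylinder of measure [2 ^- n]. *)
Lemma coin_tossing_set1 (R : realType) (mu : probability cantor_borel R) :
  coin_tossing mu -> forall A, measurable A -> is_subset1 A -> mu A = 0%E.
Proof.
move=> hmu A mA sA; have [->|/set0P[x Ax]] := eqVneq A set0; first exact: measure0.
apply/eqP; rewrite eq_le measure_ge0 andbT; apply/lee_addgt0Pr => e e0.
rewrite add0e; have [n hn] : exists n, 2 ^- n < e.
  have := @near_infty_natSinv_expn_lt R (PosNum e0) => -[n _ /(_ n)] /= h.
  by exists n; rewrite -[_^-1]mul1r h /=.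
rewrite (le_trans _ (ltW _ : ((2 ^- n)%:E <= e%:E)%E)) ?lte_fin // -(hmu n x).
apply: le_measure; rewrite ?inE //; first by apply: sub_sigma_algebra; exists n, x.
by move=> y Ay; rewrite (sA _ _ Ay Ax).
Qed.

(** * Resampling one column of a point *)

Definition column (i : nat) (w : cantor_borel) : cantor_borel := fun j => w (pickle (i, j)).

(** Positions that code no pair belong to no column and are kept. *)
Definition upd (i : nat) (w f : cantor_borel) : cantor_borel := fun n =>
  if pickle_inv n is Some p then if p.1 == i then f p.2 else w n else w n.

Lemma column_upd i w f : column i (upd i w f) = f.
Proof. by apply/funext => j; rewrite /column /upd pickleK_inv eqxx. Qed.

Lemma column_upd_neq i k w f : k != i -> column k (upd i w f) = column k w.
Proof. by move=> /negPf ki; apply/funext => j; rewrite /column /upd pickleK_inv /= ki. Qed.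

Lemma upd_comm i k w f g : k != i -> upd i (upd k w g) f = upd k (upd i w f) g.
Proof.
move=> /negPf ki; apply/funext => n; rewrite /upd.
by case: pickle_inv => // -[l j] /=; case: (eqVneq l i) => // ->; rewrite eq_sym ki.
Qed.

Definition updp (i : nat) (p : cantor_borel * cantor_borel) := upd i p.1 p.2.

Lemma measurable_updp i : measurable_fun setT (updp i).
Proof.
apply: measurable_fun_cantor => n b; rewrite /updp /upd.
have m1 k : measurable [set p : cantor_borel * cantor_borel | p.1 k = b].
  rewrite -[X in measurable X]setTI.
  exact: (@measurable_fst _ _ cantor_borel cantor_borel measurableT _ (measurable_bit k b)).
have m2 k : measurable [set p : cantor_borel * cantor_borel | p.2 k = b].
  rewrite -[X in measurable X]setTI.
  exact: (@measurable_snd _ _ cantor_borel cantor_borel measurableT _ (measurable_bit k b)).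
by case: pickle_inv => [[k j]|] //=; case: eqP.
Qed.

HB.instance Definition _ i := isMeasurableFun.Build _ _ _ _ (updp i) (measurable_updp i).

(** The first [n] bits of [upd i w f] are bits of [w] outside column [i] and bits of [f], at [n]
    distinct places in all. The product measure treats them as independent. *)
Lemma coin_tossing_updp (R : realType) (mu : probability cantor_borel R) i :
  coin_tossing mu -> coin_tossing (distribution (mu \x mu)%E (updp i)).
Proof.
move=> hmu n s; rewrite /distribution /pushforward.
(* [c m] says that position [m] lies in column [i], and [j m] is then its place there. The bits are
   read from [w] at [l1] and from [f] at [l2]. *)
pose c (m : nat) : bool := if pickle_inv m is Some p then (p : nat * nat).1 == i else false.
pose j (m : nat) : nat := if pickle_inv m is Some p then (p : nat * nat).2 else 0%N.
pose l1 := [seq m <- iota 0 n | ~~ c m]; pose l2 := [seq j m | m <- iota 0 n & c m].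
have jK m : c m -> pickle (i, j m) = m.
  rewrite /c /j; have := @pickle_invK (nat * nat)%type m; case: pickle_inv => //= -[a b] /= e /eqP <-.
  exact: e.
have u2 : uniq l2.
  rewrite map_inj_in_uniq ?filter_uniq ?iota_uniq // => a b.
  by rewrite !mem_filter => /andP[ca _] /andP[cb _] e; rewrite -(jK a ca) -(jK b cb) e.
have u1 : uniq l1 by rewrite filter_uniq ?iota_uniq.
transitivity ((mu \x mu)%E ([set x : cantor_borel | {in l1, forall k, x k = s k}] `*`
    [set x : cantor_borel | {in l2, forall k, x k = s (pickle (i, k))}])).
  apply: (congr1 (mu \x mu)%E); apply/seteqP; split=> -[w f] /=.
    move=> h; split=> [m|_ /mapP[m + ->]]; rewrite mem_filter mem_iota /=.
      move=> /andP[+ /h <-]; rewrite /updp /upd /= /c; by case: pickle_inv => // p /negPf ->.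
    move=> /andP[cm /h]; rewrite jK // => <-; move: cm; rewrite /updp /upd /= /c /j.
    by case: pickle_inv => // p ->.
  move=> [h1 h2] m mn; case cm : (c m).
    have : j m \in l2 by apply: map_f; rewrite mem_filter cm mem_iota.
    move=> /h2; rewrite jK // => <-; move: cm; rewrite /updp /upd /= /c /j.
    by case: pickle_inv => // p ->.
  have : m \in l1 by rewrite mem_filter cm mem_iota.
  by move=> /h1 <-; move: cm; rewrite /updp /upd /= /c; case: pickle_inv => // p ->.
rewrite product_measure1E; try exact: measurable_constraints.
transitivity ((2 ^- size l1)%:E * (2 ^- size l2)%:E : \bar R)%E.
  by congr (_ * _)%E; exact: coin_tossing_seq.
rewrite -EFinM -invfM -exprD size_map; congr (2 ^- _)%:E.
by rewrite !size_filter addnC count_predC size_iota.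
Qed.

Lemma measurable_upd_section i w (S : set cantor_borel) :
  measurable S -> measurable [set f | S (upd i w f)].
Proof.
move=> mS; have := measurable_fun_pair2 w (measurable_updp i).
by move=> /(_ measurableT _ mS); rewrite setTI.
Qed.

Lemma measurable_fun_upd (R : realType) (mu : probability cantor_borel R) i
    (S : set cantor_borel) :
  measurable S -> measurable_fun setT (fun w => mu [set f | S (upd i w f)]).
Proof.
move=> mS; have mA : measurable (updp i @^-1` S).
  by rewrite -[X in measurable X]setTI; exact: measurable_updp.
have := measurable_fun_xsection mu mA; congr (measurable_fun _ _).
by apply/funext => w /=; congr (mu _); apply/seteqP; split=> f; rewrite /xsection /= inE.
Qed.

Lemma measurable_upd_null (R : realType) (mu : probability cantor_borel R) i
    (S : set cantor_borel) :
  measurable S -> measurable [set w | mu [set f | S (upd i w f)] = 0%E].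
Proof.
move=> mS; rewrite (_ : [set _ | _] =
  setT `&` (fun w => mu [set f | S (upd i w f)]) @^-1` [set 0%E]).
  by apply: measurable_fun_upd => //; exact: emeasurable_set1.
by rewrite setTI.
Qed.

(** The form of Fubini used below: as resampling preserves [mu], the measure of [S] is the integral
    of the measures of its sections, and a nonnegative integral vanishes exactly when its integrand
    does almost everywhere. *)
Lemma coin_tossing_upd_null (R : realType) (mu : probability cantor_borel R) i
    (S : set cantor_borel) :
  coin_tossing mu -> measurable S ->
  mu S = 0%E <-> mu.-negligible [set w | mu [set f | S (upd i w f)] <> 0%E].
Proof.
move=> hmu mS.
have mA : measurable (updp i @^-1` S).
  by rewrite -[X in measurable X]setTI; exact: measurable_updp.
have -> : mu S = (\int[mu]_w `|mu [set f | S (upd i w f)]|)%E.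
  rewrite (coin_tossing_unique hmu (coin_tossing_updp i hmu) mS).
  apply: eq_integral => w _ /=; rewrite gee0_abs ?measure_ge0 //; congr (mu _).
  by apply/seteqP; split=> f; rewrite /xsection /= inE.
apply: iff_trans (ae_eq_integral_abs mu measurableT (measurable_fun_upd mu i mS)) _.
split; apply: negligibleS => w /= h; first by move/(_ I).
by move=> e; apply: h.
Qed.

(** * Symbolic computations *)

(* [SFun i] is column [i.+1], [SSet] the unknown set, [SMeas] the functional
   [lambda_C]. *)
Inductive sarg := SNum of nat | SFun of nat | SSet | SE2 | SMeas.

Definition sarg_code (a : sarg) : nat * nat :=
  match a with
  | SNum n => (0, n) | SFun i => (1, i)
  | SSet => (2, 0) | SE2 => (3, 0) | SMeas => (4, 0)
  end%N.

Definition sarg_decode (p : nat * nat) : option sarg :=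
  match p.1 with
  | 0 => Some (SNum p.2) | 1 => Some (SFun p.2)
  | 2 => Some SSet | 3 => Some SE2 | _ => Some SMeas
  end%N.

Lemma sarg_codeK : pcancel sarg_code sarg_decode. Proof. by case. Qed.

HB.instance Definition _ := Countable.copy sarg (pcan_type sarg_codeK).

(** States are countable, so exceptional null sets, one for each state, have a null union. *)
Definition state := (nat * seq sarg)%type.

(** The shapes of a single computation step, with recursive calls left symbolic. Facts about steps
    are then proved by cases on these shapes instead of on indices. *)
Inductive instr :=
| IUndef
| IRet of nat
| IBit of nat & nat
| ICall of state
| IBind of state & (nat -> state)
| IZero of (nat -> state)
| IE2 of (nat -> state)
| IMeas of nat & nat & state.

(** Exceeds every column index occurring in [s], so that resampling the new column leaves the
    arguments in [s] unchanged. *)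
Definition fresh (s : seq sarg) : nat :=
  (\max_(a <- s) (if a is SFun i then i.+1 else 0))%N.

Definition instr_of (c : state) : instr :=
  let: (e, s) := c in
  match CodeSeq.decode e with
  | [:: 1] => if s is SNum x :: _ then IRet x.+1 else IUndef
  | [:: 2; q] => IRet q
  | [:: 3] => if s is SNum x :: _ then IRet x else IUndef
  | [:: 4; d1; d2] => IBind (d2, s) (fun x => (d1, SNum x :: s))
  | [:: 5; d1; d2] =>
    match s with
    | SNum 0 :: s' => ICall (d1, s')
    | SNum x.+1 :: s' => IBind (e, SNum x :: s') (fun z => (d2, [:: SNum x, SNum z & s']))
    | _ => IUndef
    end
  | 6 :: d :: p =>
    if perm_eq p (iota 0 (size s)) then ICall (d, [seq nth (SNum 0) s i | i <- p])
    else IUndef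
  | [:: 7] => if s is SFun i :: SNum x :: _ then IBit i x else IUndef
  | [:: 8; 2; d] =>
    match s with
    | SSet :: _ => IZero (fun n => (d, SNum n :: s))
    | SE2 :: _ => IE2 (fun n => (d, SNum n :: s))
    | _ => IUndef
    end
  | [:: 8; 3; d] =>
    if s is SMeas :: SNum x :: _ then IMeas (fresh s) x (d, SFun (fresh s) :: s)
    else IUndef
  | [:: 9; m] =>
    if s is SNum x :: s' then
      if (m <= size s')%N then ICall (x, take m s') else IUndef
    else IUndef
  | _ => IUndef
  end%N.

Definition system := state -> cantor_borel -> option nat.

Definition dyadic (R : realType) (n : nat) (r : R) : nat :=
  CodeSeq.code [:: kn n r; (2 ^ n)%N].

Section Systems.
Context (R : realType) (mu : probability cantor_borel R).
Implicit Types (V W : system) (c : state) (w f : cantor_borel).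

(* [IZero] is S8 with the empty set as oracle.  [IMeas] replaces the totality
   required by S8 at type 3 by definedness at almost all points of 2^N, and does
   not require the set to be closed. *)
Definition exec V (i : instr) w : option nat :=
  match i with
  | IUndef => None
  | IRet y => Some y
  | IBit i x => Some (nat_of_bool (column i.+1 w x))
  | ICall c => V c w
  | IBind c k => obind (fun x => V (k x) w) (V c w)
  | IZero c => if `[< forall n, V (c n) w <> None >] then Some 0%N else None
  | IE2 c => if `[< forall n, V (c n) w <> None >] then
       if `[< exists n, V (c n) w = Some 0%N >] then Some 0%N else Some 1%N else None
  | IMeas i x c => if `[< mu [set f | V c (upd i.+1 w f) = None] = 0%E >] then
       Some (dyadic x (fine (mu [set f | V c (upd i.+1 w f) = Some 1%N]))) else None
  end.

Definition step V : system := fun c => exec V (instr_of c).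

(** Agreement on the common domain rather than extension, since the systems built below need not
    form a chain. *)
Definition compatible V W := forall c w y z, V c w = Some y -> W c w = Some z -> y = z.

Definition measurable_system V := forall c o, measurable [set w | V c w = o].

Definition invariant0 V := forall c w f, V c (upd 0 w f) = V c w.

Lemma compatible_sym V W : compatible V W -> compatible W V.
Proof. by move=> h c w y z Wy Vz; rewrite (h _ _ _ _ Vz Wy). Qed.

Lemma measurable_fibers (g : cantor_borel -> option nat) (H : option nat -> set cantor_borel) :
  (forall o, measurable [set w | g w = o]) -> (forall o, measurable (H o)) ->
  measurable [set w | H (g w) w].
Proof.
move=> mg mH; rewrite (_ : [set _ | _] = \bigcup_o ([set w | g w = o] `&` H o)).
  apply: countable_bigcupT_measurable => [|o]; first exact: countableP.
  exact: measurableI.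
apply/seteqP; split=> w; first by exists (g w).
by case=> o _ [] <-.
Qed.

Lemma measurable_if (Q : set cantor_borel) (g h : cantor_borel -> option nat) o :
  measurable Q -> measurable [set w | g w = o] -> measurable [set w | h w = o] ->
  measurable [set w | (if `[< Q w >] then g w else h w) = o].
Proof.
move=> mQ mg mh; rewrite (_ : [set _ | _] =
  (Q `&` [set w | g w = o]) `|` (~` Q `&` [set w | h w = o])).
  by apply: measurableU; apply: measurableI => //; exact: measurableC.
apply/seteqP; split=> w /=; first by case: asboolP => ? ?; [left|right].
by case=> -[Qw <-]; case: asboolP.
Qed.

Lemma measurable_prop (P : Prop) : measurable ([set _ | P] : set cantor_borel).
Proof.
have [p|np] := pselect P.
  by rewrite (_ : [set _ | _] = setT) //; apply/seteqP; split.
by rewrite (_ : [set _ | _] = set0) //; apply/seteqP; split.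
Qed.

(** The case that matters is [IMeas]: compatible systems that are both defined almost everywhere
    agree almost everywhere, so the two sets being measured have equal measure. *)
Lemma step_compatible V W : measurable_system V -> measurable_system W ->
  compatible V W -> compatible (step V) (step W).
Proof.
move=> mV mW VW c w y z; rewrite /step; case: (instr_of c) => //=.
- by move=> n [<-] [<-].
- by move=> i x [<-] [<-].
- by move=> d; exact: VW.
- move=> d k; case Vd : (V d w) => [a|] //=; case Wd : (W d w) => [b|] //=.
  by rewrite (VW _ _ _ _ Vd Wd); exact: VW.
- by move=> d; do 2 case: asboolP => // _; move=> [<-] [<-].
- move=> d; case: (asboolP (forall n, V (d n) w <> None)) => // Vd.
  case: (asboolP (forall n, W (d n) w <> None)) => // Wd.
  have VWd n : V (d n) w = W (d n) w.
    case Vn : (V (d n) w) => [a|]; last by have := Vd n; rewrite Vn.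
    case Wn : (W (d n) w) => [b|]; last by have := Wd n; rewrite Wn.
    by rewrite (VW _ _ _ _ Vn Wn).
  rewrite (_ : (exists n, V (d n) w = Some 0%N) = (exists n, W (d n) w = Some 0%N)).
    by case: asboolP => _ [<-] [<-].
  by apply/propext; split=> -[n h]; exists n; rewrite -h VWd.
- move=> i x d; case: asboolP => // V0; case: asboolP => // W0 [<-] [<-].
  congr (dyadic _ (fine _)).
  have mS U o : measurable_system U -> measurable [set f | U d (upd i.+1 w f) = o].
    by move=> mU; apply: (measurable_upd_section i.+1 w (mU d o)).
  have sub U U' : compatible U U' -> measurable_system U -> measurable_system U' ->
    mu [set f | U' d (upd i.+1 w f) = None] = 0%E ->
    (mu [set f | U d (upd i.+1 w f) = Some 1%N] <=
     mu [set f | U' d (upd i.+1 w f) = Some 1%N])%E.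
    move=> UU' mU mU' U'0.
    apply: (@le_trans _ _ (mu ([set f | U' d (upd i.+1 w f) = Some 1%N] `|`
              [set f | U' d (upd i.+1 w f) = None]))).
      apply: le_measure; rewrite ?inE //; try exact: mS.
        by apply: measurableU; exact: mS.
      move=> f /= Uf; case U'f : (U' d _) => [a|]; last by right.
      by rewrite -(UU' _ _ _ _ Uf U'f); left.
    rewrite measureU; try exact: mS.
      by rewrite -[leRHS]adde0 -U'0.
    by apply/seteqP; split=> f //= [->].
  by apply/eqP; rewrite eq_le !sub //; exact: compatible_sym.
Qed.

Lemma step_measurable V : measurable_system V -> measurable_system (step V).
Proof.
move=> mV c o; have mD (d : nat -> state) : measurable [set w | forall n, V (d n) w <> None].
  rewrite (_ : [set _ | _] = \bigcap_n ~` [set w | V (d n) w = None]).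
    by apply: bigcap_measurableType => n _; apply: measurableC; exact: mV.
  by apply/seteqP; split=> w h n; [move=> _; apply: h|apply: (h n)].
rewrite /step; case: (instr_of c) => /=.
- exact: measurable_prop.
- by move=> n; exact: measurable_prop.
- move=> i x; rewrite (_ : [set _ | _] =
    [set w | (if `[< column i.+1 w x = true >] then Some 1%N else Some 0%N) = o]).
    apply: measurable_if; try exact: measurable_prop.
    exact: (measurable_bit (pickle (i.+1, x)) true).
  by apply/seteqP; split=> w /=; case: asboolP => [->|] //; case: (column _ _ _).
- by move=> d; exact: mV.
- move=> d k; apply: (measurable_fibers (H := fun o' => [set w | obind (fun x => V (k x) w) o' = o])) => //.
  by case=> [x|] /=; [exact: mV|exact: measurable_prop].
- by move=> d; apply: measurable_if; [exact: mD| |]; exact: measurable_prop.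
- move=> d; apply: measurable_if; [exact: mD| |exact: measurable_prop].
  apply: measurable_if; try exact: measurable_prop.
  suff -> : (fun w => exists n, V (d n) w = Some 0%N) = \bigcup_n [set w | V (d n) w = Some 0%N].
    by apply: bigcup_measurable => n _; exact: mV.
  by apply/seteqP; split=> w [n]; [exists n|move=> _; exists n].
- move=> i x d; apply: measurable_if; try exact: measurable_prop.
    exact: (measurable_upd_null mu i.+1 (mV d None)).
  (* The result factors through the integer [kn x (fine (g w))], whose fibers are measurable because
     [g] is. *)
  pose g w := mu [set f | V d (upd i.+1 w f) = Some 1%N].
  have mg : measurable_fun setT g := measurable_fun_upd mu i.+1 (mV d (Some 1%N)).
  have mk k : measurable [set w | Some (kn x (fine (g w))) = k].
    case: k => [k|]; last by rewrite (_ : [set _ | _] = set0) //; apply/seteqP; split.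
    rewrite (_ : [set _ | _] = setT `&` (fine \o g) @^-1` [set r | kn x r = k]).
      have mf := measurableT_comp (fine_measurable measurableT) mg.
      exact: (mf measurableT _ (measurable_kn x k)).
    by rewrite setTI; apply/seteqP; split=> w /=; [case|move=> ->].
  apply: (measurable_fibers (H := fun k => [set w | omap (fun k => CodeSeq.code [:: k; (2 ^ x)%N]) k = o])) mk _.
  by move=> k; exact: measurable_prop.
Qed.

(** Bits are read and columns resampled only at indices [i.+1], and resampling commutes with a
    change of column 0. *)
Lemma step_invariant0 V : invariant0 V -> invariant0 (step V).
Proof.
move=> iV c w f; rewrite /step; case: (instr_of c) => //=.
- by move=> i x; rewrite column_upd_neq.
- by move=> d k; rewrite iV; case: (V d w) => //= a.
- by move=> d; under eq_forall do rewrite iV.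
- by move=> d; under eq_forall do rewrite iV; under eq_exists do rewrite iV.
- move=> i x d.
  have e o : [set g | V d (upd i.+1 (upd 0 w f) g) = o] = [set g | V d (upd i.+1 w g) = o].
    by apply/seteqP; split=> g /=; rewrite upd_comm ?iV.
  by rewrite !e.
Qed.

(** An arbitrary value among those taken by the members is chosen; for stages there is only one, by
    compatibility. *)
Definition join (V : nat -> system) : system := fun c w =>
  xget None [set o | o <> None /\ exists n, V n c w = o].

Lemma join_some (V : nat -> system) c w y : join V c w = Some y -> exists n, V n c w = Some y.
Proof. by rewrite /join; case: xgetP => // o -> [_ [n <-]] e; exists n. Qed.

Lemma join_none (V : nat -> system) c w n : join V c w = None -> V n c w = None.
Proof.
rewrite /join; case: xgetP => [z -> [zn _] //|no _].
by case e : (V n c w) => [a|] //; have [] := no (Some a); split=> //; exists n.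
Qed.

(** Measurability is a premise of [stage_step] to avoid a circle: stages are proved measurable
    through their compatibility, which rests on [step_compatible]. *)
Inductive stage : system -> Prop :=
| stage_bot : stage (fun _ _ => None)
| stage_step V : stage V -> measurable_system V -> stage (step V)
| stage_join (V : nat -> system) : (forall n, stage (V n)) -> stage (join V).

End Systems.

(** * A maximal system *)

Section Stages.
Context (R : realType) (mu : probability cantor_borel R).
Implicit Types (V W : system) (c : state) (w f : cantor_borel).

Lemma stage_compatible V W : stage mu V -> stage mu W -> compatible V W.
Proof.
move=> sV; elim: sV W => [W _ c w y z //|V' sV' IH mV' W sW|Vn sVn IH W sW c w y z].
  elim: sW => [c w y z //|W' sW' _ mW'|Wn sWn IHW c w y z Vy /join_some[n Wz]].
    exact: step_compatible (IH W' sW').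
  exact: IHW n c w y z Vy Wz.
by move=> /join_some[n Vy]; exact: (IH n W sW c w y z Vy).
Qed.

Lemma stage_join_some (V : nat -> system) c w n y :
  (forall n, stage mu (V n)) -> V n c w = Some y -> join V c w = Some y.
Proof.
move=> sV Vy; case e : (join V c w) => [z|]; last by rewrite (join_none n e) in Vy.
have [m Vz] := join_some e; congr Some.
exact: (stage_compatible (sV m) (sV n) Vz Vy).
Qed.

Lemma stage_measurable V : stage mu V -> measurable_system V.
Proof.
elim=> {V} [c o|V sV mV _|V sV mV c o]; [exact: measurable_prop|exact: step_measurable|].
case: o => [y|].
  rewrite (_ : [set _ | _] = \bigcup_n [set w | V n c w = Some y]).
    by apply: bigcup_measurable => n _; exact: mV.
  apply/seteqP; split=> w /=; first by move=> /join_some[n h]; exists n.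
  by case=> n _ /=; exact: stage_join_some.
rewrite (_ : [set _ | _] = \bigcap_n [set w | V n c w = None]).
  by apply: bigcap_measurableType => n _; exact: mV.
apply/seteqP; split=> w /= h; first by move=> n _; exact: join_none h.
by case e : (join V c w) => [y|] //; have [n] := join_some e; rewrite (h n).
Qed.

Lemma stage_invariant0 V : stage mu V -> invariant0 V.
Proof.
elim=> {V} [//|V _ iV _|V _ iV c w f]; first exact: step_invariant0.
rewrite /join; congr (xget _ _); apply/seteqP; split=> z /= [zn [n e]]; split=> //;
  by exists n; rewrite -e iV.
Qed.

Definition dom V c : set cantor_borel := [set w | V c w <> None].

Lemma measurable_dom V c : stage mu V -> measurable (dom V c).
Proof. by move=> /stage_measurable mV; apply: measurableC; exact: mV. Qed.

(* The supremum is attained for all states at once by one countable join. *)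
Lemma stage_sup : exists2 U, stage mu U &
  forall V c, stage mu V -> (mu (dom V c) <= mu (dom U c))%E.
Proof.
pose s c := ereal_sup [set mu (dom V c) | V in stage mu].
have sup V c : stage mu V -> (mu (dom V c) <= s c)%E.
  by move=> sV; apply: ereal_sup_ubound; exists V.
have fs c : s c \is a fin_num.
  rewrite fin_numElt (lt_le_trans (ltNyr 0)) ?(le_lt_trans _ (ltry 1)) //.
    apply: ge_ereal_sup => _ [V sV <-]; apply: probability_le1.
    exact: measurable_dom.
  by apply: (le_trans _ (sup _ c (stage_bot mu))); exact: measure_ge0.
have /choice[A hA] (p : state * nat) : exists V, stage mu V /\
    (s p.1 - (p.2.+1%:R^-1)%:E < mu (dom V p.1))%E.
  have e0 : 0 < p.2.+1%:R^-1 :> R by rewrite invr_gt0.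
  by have [_ [V sV <-] h] := ub_ereal_sup_adherent e0 (fs p.1); exists V.
pose B k : system := if unpickle k is Some p then A p else fun _ _ => None.
have sB k : stage mu (B k).
  by rewrite /B; case: unpickle => [p|]; [case: (hA p)|exact: stage_bot].
have sU : stage mu (join B) by exact: stage_join.
exists (join B) => // V c sV; apply: le_trans (sup V c sV) _.
apply/lee_addgt0Pr => e e0.
have [n _ /(_ n (leqnn n)) /= ne] := near_infty_natSinv_lt (PosNum e0).
have [_ /ltW] := hA (c, n).
rewrite leeBlDr // => h; apply: le_trans h _; apply: leeD; last by rewrite lee_fin ltW.
apply: le_measure; rewrite ?inE; [|exact: measurable_dom|].
  by apply: measurable_dom; case: (hA (c, n)).
move=> w /= h; have : B (pickle (c, n)) c w <> None by rewrite /B pickleK.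
case e1 : (B _ _ _) => [y|] // _; have := stage_join_some sB e1; rewrite /dom /=.
by move=> ->.
Qed.

(** Joining the maximal stage [U] with its own step cannot enlarge any domain by more than a null
    set, and compatibility gives equal values where both are defined. *)
Lemma stage_fixpoint : exists2 U, stage mu U & forall c,
  mu.-negligible [set w | step mu U c w <> None /\ U c w <> step mu U c w].
Proof.
have [U sU maxU] := stage_sup; exists U => // c.
have sT : stage mu (step mu U) by apply: stage_step => //; exact: stage_measurable.
pose B n : system := if n is 0%N then U else step mu U.
have sB n : stage mu (B n) by case: n.
have sX : stage mu (join B) by exact: stage_join.
have BX n : dom (B n) c `<=` dom (join B) c.
  move=> w; rewrite /dom /=; case e : (B n c w) => [y|] // _.
  by rewrite (stage_join_some sB e).
exists (dom (join B) c `\` dom U c); split.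
- by apply: measurableD; exact: measurable_dom.
- have -> := measureD (measurable_dom c sX) (measurable_dom c sU) _.
    have -> : dom (join B) c `&` dom U c = dom U c by apply/setIidPr; exact: (BX 0%N).
    apply/eqP; rewrite eq_le; apply/andP; split.
      rewrite leeBlDr ?add0e ?maxU // fin_num_measure //; exact: measurable_dom.
    rewrite sube_ge0; last by rewrite fin_num_measure //; exact: measurable_dom.
    by apply: le_measure; rewrite ?inE; [exact: measurable_dom..|exact: (BX 0%N)].
  apply: le_lt_trans (ltry 1); apply: probability_le1; exact: measurable_dom.
- move=> w [Tw UTw]; split; first exact: (BX 1%N).
  move: Tw UTw; rewrite /dom /=; case e : (step mu U c w) => [y|] // _.
  case e' : (U c w) => [z|] h nN; last exact: nN.
  apply: h.
  by rewrite (stage_compatible sU sT e' e).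
Qed.

Lemma negligible_bigcup_count (T : countType) (N : T -> set cantor_borel) :
  (forall t, mu.-negligible (N t)) -> mu.-negligible (\bigcup_t N t).
Proof.
move=> hN; apply: (@negligibleS _ _ _ _ (\bigcup_k (if unpickle k is Some t then N t else set0))).
  by move=> w [t _ Nw]; exists (pickle t) => //; rewrite pickleK.
apply: negligible_bigcup => k; case: unpickle => [t|] //; exact: negligible_set0.
Qed.

(** [next] adds the points at which some resampling hits the set with positive measure; by Fubini
    these form a null set. After countably many rounds nothing is left to add. *)
Lemma null_closure (N : set cantor_borel) : coin_tossing mu -> mu.-negligible N ->
  exists Z : set cantor_borel, [/\ measurable Z, mu Z = 0%E, N `<=` Z &
    forall w i, ~ Z w -> mu [set f | Z (upd i w f)] = 0%E].
Proof.
move=> hmu [N0 [mN0 N00 NN0]].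
pose next (Y : set cantor_borel) := Y `|` \bigcup_i [set w | mu [set f | Y (upd i w f)] <> 0%E].
pose Z n := iter n next N0.
have mnext Y : measurable Y -> measurable (next Y).
  move=> mY; apply: measurableU => //; apply: bigcup_measurable => i _.
  by apply: measurableC; exact: measurable_upd_null.
have mZ n : measurable (Z n) by elim: n => //= n; exact: mnext.
have Z0 n : mu (Z n) = 0%E.
  elim: n => //= n IH; apply: measure_negligible; first exact: (mZ n.+1).
  apply: negligibleU; first by apply/negligibleP.
  by apply: negligible_bigcup => i; apply/(coin_tossing_upd_null i hmu (mZ n)).
exists (\bigcup_n Z n); split.
- exact: bigcup_measurable.
- apply: measure_negligible; first exact: bigcup_measurable.
  by apply: negligible_bigcup => n; apply/negligibleP; [exact: mZ|exact: Z0].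
- by move=> w /NN0 h; exists 0%N.
move=> w i nZ; apply: (@measure_negligible _ _ _ _ (\bigcup_n [set f | Z n (upd i w f)])).
  by apply: bigcup_measurable => n _; exact: measurable_upd_section.
apply: negligible_bigcup => n; apply/negligibleP; first exact: measurable_upd_section.
apply: contrapT => h; apply: nZ; exists n.+1 => //=; right; exists i => //.
Qed.

End Stages.

(** * Actual computations follow the maximal system *)

Section Simulation.
Context (R : realType) (mu : probability cantor_borel R).
Implicit Types (c : state) (w x : cantor_borel).

Definition indicator1 x : fun2 := fun g => if `[< g = seq01 x >] then 1%N else 0%N.

Lemma seq01_inj : injective seq01.
Proof.
move=> x y e; apply/funext => n; have := congr1 (fun g => g n) e.
by rewrite /seq01; case: (x n); case: (y n).
Qed.

Lemma Omega_b_set0 : Omega_b (fun _ => 0%N) = Some 0%N.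
Proof.
have s0 : Defs.set_of (fun _ => 0%N) = set0 by apply/seteqP; split.
rewrite /Omega_b s0; case: asboolP => [_|[]]; first by case: asboolP.
by split=> // x y [].
Qed.

Lemma Omega_b_set1 x : Omega_b (indicator1 x) = Some 1%N.
Proof.
have s1 : Defs.set_of (indicator1 x) = [set x].
  apply/seteqP; split=> y; rewrite /Defs.set_of /indicator1 /=.
    by case: asboolP => // /seq01_inj.
  by move=> ->; case: asboolP.
rewrite /Omega_b s1; case: asboolP => [_|[]].
  case: asboolP => // e; have : [set x] x by [].
  by rewrite e.
by split=> [y|y z -> ->] //; rewrite /indicator1; case: asboolP.
Qed.

Definition interp (F : fun2) w (a : sarg) : arg :=
  match a with
  | SNum n => A0 n
  | SFun i => A1 (seq01 (column i.+1 w))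
  | SSet => A2 F
  | SE2 => A2 E2
  | SMeas => A3 (lambda_C mu)
  end.

Lemma interp_upd F w f s : [seq interp F (upd (fresh s).+1 w f) a | a <- s] = map (interp F w) s.
Proof.
apply/eq_in_map => -[] //= i si; congr (A1 (seq01 _)); apply: column_upd_neq.
rewrite eqSS neq_ltn /fresh; apply/orP; left.
exact: (@leq_bigmax_seq _ s xpredT (fun a => if a is SFun i then i.+1 else 0%N) (SFun i) si isT).
Qed.

(* For almost all [w] the oracle [F] vanishes at every function computed from [w]:
   if [F] is the indicator of the first column, this column is independent of
   the other ones. *)
Lemma kleene_simulation (V : system) (Z : set cantor_borel) (F : fun2) :
  measurable_system V -> measurable Z ->
  (forall c w y, ~ Z w -> step mu V c w = Some y -> V c w = Some y) ->
  (forall e s w, ~ Z w -> ~ forall n, V (e, SNum n :: s) w = Some (seq01 (column 0 w) n)) ->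
  (forall w i, ~ Z w -> mu [set f | Z (upd i w f)] = 0%E) ->
  forall e args y, kleene e args y ->
  forall s w, ~ Z w -> F = (fun=> 0%N) \/ F = indicator1 (column 0 w) ->
  args = map (interp F w) s -> V (e, s) w = Some y.
Proof.
move=> mV mZ fixV diagV Z0 e args y; elim=> {e args y}.
- by move=> x args [|[x'|?|||] s] // w nZ _ [-> _]; exact: fixV.
- move=> q args s w nZ _ _; apply: fixV => //.
  by rewrite /step /instr_of /idx CodeSeq.codeK.
- by move=> x args [|[x'|?|||] s] // w nZ _ [-> _]; exact: fixV.
- move=> d1 d2 args x y _ IH2 _ IH1 s w nZ hF es; apply: fixV => //.
  rewrite /step /instr_of /idx CodeSeq.codeK /= (IH2 s w nZ hF es) /=.
  by apply: IH1; rewrite //= es.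
- move=> d1 d2 args y _ IH [|[x'|?|||] s] // w nZ hF [<- es]; apply: fixV => //.
  by rewrite /step /instr_of /idx CodeSeq.codeK /=; exact: IH.
- move=> d1 d2 args x z y _ IHz _ IHy [|[x'|?|||] s] // w nZ hF [<- es]; apply: fixV => //.
  rewrite /step /instr_of /idx CodeSeq.codeK /= (IHz (SNum x :: s) w nZ hF) /= ?es //.
  by apply: IHy; rewrite //= es.
- move=> d p args y pp _ IH s w nZ hF es; apply: fixV => //.
  rewrite /step /instr_of /idx CodeSeq.codeK /=; move: pp; rewrite es size_map => -> /=.
  apply: IH => //; rewrite es -map_comp; apply/eq_map => i /=.
  have [si|si] := ltnP i (size s); first by rewrite (nth_map (SNum 0)).
  by rewrite !nth_default ?size_map.
- by move=> f x args [|[?|i|||] [|[x'|?|||] s]] // w nZ hF [-> -> _]; exact: fixV.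
- move=> d G args f _ IH [|a s] // w nZ hF [ea es].
  have Vf n : V (d, [:: SNum n, a & s]) w = Some (f n) by apply: IH; rewrite //= -ea es.
  case: a ea Vf => // -[eG] Vf; rewrite eG; apply: fixV => //; rewrite /step /instr_of /idx CodeSeq.codeK /=.
    case: asboolP => [_|[n]]; last by rewrite Vf.
    (* The value 0 of [IZero] is also right for the indicator: [diagV] excludes that the computed
       function [f] is column 0. *)
    case: hF => -> //; rewrite /indicator1; case: asboolP => // ef.
    by case: (diagV d (SSet :: s) w nZ) => n; rewrite Vf ef.
  case: asboolP => [_|[n]]; last by rewrite Vf.
  rewrite /E2 (_ : (exists n, V _ w = Some 0%N) = (exists n, f n = 0%N)).
    by case: asboolP.
  by apply/propext; split=> -[n]; rewrite ?Vf => h; exists n; [case: h|rewrite Vf h].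
- move=> d Phi x args G h _ IH PhiG [|[?|?|||] [|[x'|?|||] s]] // w nZ hF [ePhi ex es].
  apply: fixV => //; rewrite /step /instr_of /idx CodeSeq.codeK /=.
  set s' := [:: SMeas, SNum x' & s]; set i := fresh s'; set c := (d, SFun i :: s').
  (* Column [i.+1] is fresh and is not column 0, so at a resampled point outside [Z] the arguments
     and [F] are the same and the induction hypothesis applies. *)
  have VG f : ~ Z (upd i.+1 w f) -> V c (upd i.+1 w f) = Some (G (seq01 f)).
    move=> nZf; apply: IH => //; first by rewrite column_upd_neq.
    by rewrite map_cons interp_upd /= column_upd ePhi ex es.
  move: PhiG; rewrite ePhi /lambda_C; case: asboolP => // -[_ cG] [<-].
  have mG : measurable (Defs.set_of G : set cantor_borel) by exact: measurable_closed_cantor.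
  have mS o : measurable [set f | V c (upd i.+1 w f) = o].
    exact: (measurable_upd_section i.+1 w (mV c o)).
  have mZi : measurable [set f | Z (upd i.+1 w f)] by exact: measurable_upd_section.
  case: asboolP => [_|[]]; last first.
    apply: subset_measure0 (Z0 w i.+1 nZ) => // f /= Vf.
    by apply: contrapT => /VG; rewrite Vf.
  rewrite ex /dyadic /kn; congr (Some (CodeSeq.code [:: Num.truncn (_ * fine _); _])).
  (* The set decided by [G] and the one decided by [V] differ only on the section of [Z], which is
     null. *)
  have le (A B : set cantor_borel) : measurable A -> measurable B ->
      A `<=` B `|` [set f | Z (upd i.+1 w f)] -> (mu A <= mu B)%E.
    move=> mA mB AB.
    apply: (@le_trans _ _ (mu (B `|` [set f | Z (upd i.+1 w f)]))).
      by apply: le_measure; rewrite ?inE //; exact: measurableU.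
    apply: le_trans (measureU2 _ mB mZi) _.
    by rewrite -[leRHS]adde0 -(Z0 w i.+1 nZ).
  apply/eqP; rewrite eq_le; apply/andP; split; apply: le => // f /= Hf.
    have [Zf|/VG] := pselect (Z (upd i.+1 w f)); first by right.
    by rewrite Hf => -[e]; left; rewrite /Defs.set_of /= -e.
  have [Zf|/VG ->] := pselect (Z (upd i.+1 w f)); first by right.
  by left; rewrite /= Hf.
- move=> m x args y ms _ IH [|[x'|?|||] s] // w nZ hF [ex es]; apply: fixV => //.
  move: ms; rewrite /step /instr_of /idx CodeSeq.codeK /= -ex es size_map => ms; rewrite ms /=.
  by apply: IH => //; rewrite es map_take.
Qed.

(** Once the other columns are fixed, [V] computes a fixed function, which at most one choice of
    column 0 can equal. Sections along column 0 are thus null. *)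
Lemma diagonal_null (V : system) (k : nat -> state) : coin_tossing mu ->
  measurable_system V -> invariant0 V ->
  mu.-negligible [set w | forall n, V (k n) w = Some (seq01 (column 0 w) n)].
Proof.
move=> hmu mV iV; set D := [set w | _].
have mD : measurable D.
  rewrite (_ : D = \bigcap_n \bigcup_b ([set w | V (k n) w = Some (nat_of_bool b)] `&`
      [set w | w (pickle (0%N, n)) = b])).
    apply: bigcap_measurableType => n _; apply: countable_bigcupT_measurable => [|b].
      exact: countableP.
    by apply: measurableI; [exact: mV|exact: measurable_bit].
  apply/seteqP; split=> w h n; last by have [b _ [/= -> <-]] := h n I.
  by move=> _; exists (column 0 w n) => //; split=> //=; exact: h.
apply/negligibleP => //; apply/(coin_tossing_upd_null 0 hmu mD).
apply: (@negligibleS _ _ _ _ set0); last exact: negligible_set0.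
move=> w /=; apply; apply: (coin_tossing_set1 hmu); first exact: measurable_upd_section.
move=> f g Df Dg; apply: seq01_inj; apply/funext => n.
have := Df n; rewrite iV column_upd; have := Dg n; rewrite iV column_upd => ->.
by case.
Qed.

End Simulation.

Theorem theorem3p17 (R : realType) (mu : probability cantor_borel R)
    (hmu : coin_tossing mu) :
  ~ computable_in Omega_b [:: A3 (lambda_C mu); A2 E2].
Proof.
move=> [e he].
have [V sV fixV] := stage_fixpoint mu.
have mV := stage_measurable sV.
(* The points where the fixed-point equation fails at some state, or where some state computes
   column 0. *)
pose N : set cantor_borel :=
  (\bigcup_c [set w | step mu V c w <> None /\ V c w <> step mu V c w]) `|`
  (\bigcup_(c : state) [set w | forall n, V (c.1, SNum n :: c.2) w = Some (seq01 (column 0 w) n)]).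
have N0 : mu.-negligible N.
  apply: negligibleU; apply: negligible_bigcup_count => // c.
  exact: (diagonal_null (fun n => (c.1, SNum n :: c.2)) hmu mV (stage_invariant0 sV)).
have [Z [mZ muZ NZ Zupd]] := null_closure hmu N0.
have [w nZ] : exists w, ~ Z w.
  apply: contrapT => /forallNP allZ; have : mu setT = 1%E by exact: probability_setT.
  rewrite (_ : setT = Z) ?muZ; first by move=> /eqP; rewrite eq_sym onee_eq0.
  by apply/seteqP; split=> // w _; apply: contrapT; exact: allZ.
have val F y : F = (fun=> 0%N) \/ F = indicator1 (column 0 w) -> Omega_b F = Some y ->
    V (e, [:: SSet; SMeas; SE2]) w = Some y.
  move=> hF Fy; apply: (kleene_simulation mV mZ _ _ Zupd (he F y Fy) nZ hF) => //.
    move=> c w' z nZ' sz; apply: contrapT => Vz; apply/nZ'/NZ; left; exists c => //.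
    by split; rewrite sz.
  by move=> d s w' nZ' h; apply/nZ'/NZ; right; exists (d, s).
(* Both oracles are represented by the same symbolic state, which would have the values 0 and 1 at
   the same [w]. *)
have := val _ _ (or_introl erefl) Omega_b_set0.
by rewrite (val _ _ (or_intror erefl) (Omega_b_set1 _)).
Qed.
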